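(* Let $K$ be an oriented virtual knot represented by a minimal genus diagram $D$ with a checkerboard coloring $\xi$, and let $\xi^*$ be the dual coloring. Let $-K$, $K^*$, $K^\dag$, $K^{*\dag}$ be the inverse, the vertical mirror image, the horizontal mirror image, and the composition of both mirror images, represented by $-D$, $D^*$, $D^\dag$, $D^{*\dag}$ respectively, and colored by $\xi,\xi^*$ as induced from $D$. Then $$(\sigma_{\xi}(-K),\sigma_{\xi^*}(-K))=(\sigma_{\xi}(K),\sigma_{\xi^*}(K)),$$ $$(\sigma_{\xi}(K^{*}),\sigma_{\xi^*}(K^{*}))=(-\sigma_{\xi}(K),-\sigma_{\xi^*}(K)),$$ $$(\sigma_{\xi}(K^{\dag}),\sigma_{\xi^*}(K^{\dag}))=(-\sigma_{\xi^*}(K),-\sigma_{\xi}(K)),$$ $$(\sigma_{\xi}(K^{*\dag}),\sigma_{\xi^*}(K^{*\dag}))=(\sigma_{\xi^*}(K),\sigma_{\xi}(K)).$$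
   Context: Diagrams and surfaces. A virtual knot diagram $D$ is a generic immersed closed curve in the plane whose double points are marked as classical (with over/under information) or virtual; virtual knots are such diagrams up to generalized Reidemeister moves. Let $S_D$ be the compact oriented surface obtained from disks around the classical crossings by attaching bands along the arcs of $D$ (at virtual crossings the bands pass each other disjointly). It carries a diagram $\widetilde D$ corresponding to $D$, without virtual crossings. Let $\Sigma_D$ be the closed oriented surface obtained by capping the boundary circles of $S_D$ with disks. The supporting genus of $D$ is the genus of $\Sigma_D$; $D$ is a minimal genus diagram of $K$ if its supporting genus is minimal among all diagrams of $K$. Signatures. A checkerboard coloring $\xi$ of $D$ is a black/white coloring of the regions of $\Sigma_D\smallsetminus\widetilde D$ such that regions sharing an edge have different colors; the dual coloring $\xi^*$ interchanges black and white. At a classical crossing $c$ the incidence number is $\eta(c)=+1$ if the two local regions swept out when the over-strand is rotated counterclockwise (with respect to the orientation of the surface) to the under-strand are black, and $\eta(c)=-1$ if they are white. Let $\varepsilon(c)=\pm1$ be the writhe (sign) of $c$; $c$ is of type II if $\varepsilon(c)\eta(c)=1$ and of type I otherwise. Let $X_0,\dots,X_m$ be the white regions of $\Sigma_D\smallsetminus\widetilde D$. For $i\ne j$ let $g_{ij}=-\sum\eta(c)$, the sum over crossings adjacent to both $X_i$ and $X_j$, and $g_{ii}=-\sum_{k\neq i}g_{ik}$. The Goeritz matrix is $G_\xi(D)=(g_{ij})_{1\le i,j\le m}$, the correction term is $\mu_\xi(D)=\sum_{c\text{ of type II}}\eta(c)$, and $\sigma_\xi(D)=\operatorname{sig}(G_\xi(D))-\mu_\xi(D)$.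 The signatures of a virtual knot are those of a minimal genus diagram (the pair $\{\sigma_\xi,\sigma_{\xi^*}\}$ does not depend on the choice of such a diagram). Mirror images. $-D$ is $D$ with reversed orientation. The operation cc (crossing change) at a crossing interchanges over- and under-strand; in the Gauss diagram it reverses the arrow and changes the sign of the chord. The operation sc (sign change) changes the sign of the chord and keeps the direction of the arrow. $D^*$ is obtained from $D$ by applying cc to all crossings, $D^\dag$ by applying sc to all crossings (equivalently, $D^\dag$ is the image of $D$ under a reflection of the plane), and $D^{*\dag}$ by applying both. If $D$ is of minimal genus, so are $-D,D^*,D^\dag,D^{*\dag}$ for the virtual knots they represent. Induced colorings. A coloring is determined by the underlying flat (i.e. without over/under information) diagram, and the same symbol is used for the induced coloring on the other diagrams. For $-D$ and $D^*$ the surface is the same and the coloring $\xi$ has the same black and white regions. For $D^\dag$ and $D^{*\dag}$, whose arcs correspond to those of $D$, the coloring $\xi$ is the one having on the left side of each oriented arc the same color that $\xi$ has on the left side of the corresponding arc of $D$ (thus, under a reflection identifying the regions of $D$ with those of $D^\dag$, the coloring $\xi$ of $D$ is carried to $\xi^*$ on $D^\dag$). *)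

(* Defs.v *)
From Stdlib Require Import Relation_Operators.
From mathcomp Require Import all_boot all_order all_algebra all_field.
Set Implicit Arguments.
Unset Strict Implicit.
Unset Printing Implicit Defensive.
Import Order.TTheory GRing.Theory Num.Theory.
Local Open Scope ring_scope.

(** Virtual knot diagrams are encoded by their Gauss diagrams, i.e. by the cyclic
    word of the signed over/under passages through the classical crossings
    (virtual crossings leave no trace: diagrams with the same Gauss diagram are
    related by detour moves, and Sigma_D only depends on the Gauss diagram).

    A passage is a triple (crossing label, over?, positive sign?). *)
Definition passage := (nat * bool * bool)%type.
Definition label (p : passage) : nat := p.1.1.
Definition over (p : passage) : bool := p.1.2.
Definition positive (p : passage) : bool := p.2.

Definition opposite (p : passage) : passage := (label p, ~~ over p, positive p).

(** Every crossing is passed exactly twice, once over and once under, and both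
    passages carry the same sign. *)
Definition valid_code (w : seq passage) : bool :=
  uniq [seq (label p, over p) | p <- w] && all (fun p => opposite p \in w) w.

Record gauss_diagram := GaussDiagram {
  len : nat;
  code : len.-tuple passage;
  codeP : valid_code code }.

(** Reidemeister moves.  Words are read up to rotation (the choice of a base
    point) and renaming of the crossings.  Freshness of the labels that are
    introduced is not required here: it follows from the validity of both
    diagrams in [step]. *)

Definition rename (f : nat -> nat) (p : passage) : passage :=
  (f (label p), over p, positive p).

Definition in_order (b : bool) (p q : passage) : seq passage :=
  if b then [:: p; q] else [:: q; p].

(** The third move: a top strand passes over a middle strand (at a) and over a
    bottom strand (at b), and the middle strand passes over the bottom one (at c).
    With signs ea, eb, ec the three oriented lines T, M, B can form exactly two
    triangles, distinguished by [d]: with signs read as +1/-1, crossing a precedes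
    b on T iff d * eb = 1, a precedes c on M iff d * ec = 1, and b precedes c on B
    iff d * ea * eb * ec = 1.  The move passes from one triangle to the other. *)
Section ThirdMove.
Variables (a b c : nat) (ea eb ec d : bool).
Definition top_strand := in_order (d == eb) (a, true, ea) (b, true, eb).
Definition middle_strand := in_order (d == ec) (a, false, ea) (c, true, ec).
Definition bottom_strand :=
  in_order (d == (ea (+) eb (+) ec)) (b, false, eb) (c, false, ec).
End ThirdMove.

Inductive move : seq passage -> seq passage -> Prop :=
| MoveRotate u v : move (u ++ v) (v ++ u)
| MoveRename f w : injective f -> move w (map (rename f) w)
| Move1 a o e w : move w ([:: (a, o, e); (a, ~~ o, e)] ++ w)
| Move2Parallel a b o e u v :
    move (u ++ v) ([:: (a, o, e); (b, o, ~~ e)] ++ u ++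
                   [:: (a, ~~ o, e); (b, ~~ o, ~~ e)] ++ v)
| Move2Antiparallel a b o e u v :
    move (u ++ v) ([:: (a, o, e); (b, o, ~~ e)] ++ u ++
                   [:: (b, ~~ o, ~~ e); (a, ~~ o, e)] ++ v)
| Move3TopMiddleBottom a b c ea eb ec d u v w :
    move (top_strand a b ea eb d ++ u ++ middle_strand a c ea ec d ++ v ++
          bottom_strand b c ea eb ec d ++ w)
         (top_strand a b ea eb (~~ d) ++ u ++ middle_strand a c ea ec (~~ d) ++ v ++
          bottom_strand b c ea eb ec (~~ d) ++ w)
| Move3TopBottomMiddle a b c ea eb ec d u v w :
    move (top_strand a b ea eb d ++ u ++ bottom_strand b c ea eb ec d ++ v ++
          middle_strand a c ea ec d ++ w)
         (top_strand a b ea eb (~~ d) ++ u ++ bottom_strand b c ea eb ec (~~ d) ++ v ++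
          middle_strand a c ea ec (~~ d) ++ w).

Definition step (D D' : gauss_diagram) : Prop := move (code D) (code D').

(** A virtual knot is a class of this relation. *)
Definition same_knot : gauss_diagram -> gauss_diagram -> Prop :=
  clos_refl_sym_trans gauss_diagram step.

(** Arc [a] leads from passage [a] to passage [a + 1] (cyclically).  The type
    ['I_(len D).-1.+1] is ['I_(len D)] if there are crossings; the diagram without
    crossings has one arc, a closed loop. *)
Definition arc (D : gauss_diagram) : finType := 'I_(len D).-1.+1.

(** [(a, true)] is the left side of the oriented arc [a], [(a, false)] the right. *)
Definition side (D : gauss_diagram) : finType := (arc D * bool)%type.

Definition passage_at (D : gauss_diagram) (k : 'I_(len D)) : passage :=
  tnth (code D) k.

Section Surface.
Variable D : gauss_diagram.

Definition partner (k : 'I_(len D)) : 'I_(len D) :=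
  odflt k [pick j | (label (passage_at j) == label (passage_at k)) && (j != k)].

(** The half-edges at the crossings: [(k, true)] is the outgoing and [(k, false)]
    the incoming half-edge of passage [k]. *)
Definition half_edge : finType := ('I_(len D) * bool)%type.

Definition arc_of (h : half_edge) : arc D :=
  inord (if h.2 then h.1 else ord_pred h.1).

(** The sides of the arc lying counterclockwise, resp. clockwise, of a half-edge as
    seen from the crossing. *)
Definition ccw_side (h : half_edge) : side D := (arc_of h, h.2).
Definition cw_side (h : half_edge) : side D := (arc_of h, ~~ h.2).

(** The counterclockwise successor of a half-edge around its crossing.  The cyclic
    order is over-out, under-out, over-in, under-in at a positive crossing and
    over-out, under-in, over-in, under-out at a negative one. *)
Definition ccw_next (h : half_edge) : half_edge :=
  (partner h.1,
   if over (passage_at h.1) then h.2 == positive (passage_at h.1)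
   else h.2 != positive (passage_at h.1)).

(** The local region between [h] and [ccw_next h] joins [ccw_side h] to
    [cw_side (ccw_next h)]; the boundary circles of S_D, that is the regions of
    Sigma_D, are the classes of sides generated in this way. *)
Definition joined (s t : side D) : bool :=
  [exists h : half_edge, ((ccw_side h, cw_side (ccw_next h)) == (s, t))
                      || ((ccw_side h, cw_side (ccw_next h)) == (t, s))].

Definition region_of (s : side D) : {set side D} := [set t | connect joined s t].
Definition regions : {set {set side D}} := [set region_of s | s : side D].

(** Crossings are indexed by their over-passages. *)
Definition crossings : {set 'I_(len D)} := [set k | over (passage_at k)].

(** S_D has one disk for each of the n crossings and 2n bands (it is an annulus if
    n = 0), hence Euler characteristic n - 2n; every region adds a disk. *)
Definition euler_characteristic : int :=
  #|crossings|%:Z - (2 * #|crossings|)%N%:Z + #|regions|%:Z.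
Definition supporting_genus : int := ((2 - euler_characteristic) %/ 2)%Z.

End Surface.

Definition minimal_genus (D : gauss_diagram) : Prop :=
  forall D' : gauss_diagram, same_knot D D' ->
    supporting_genus D <= supporting_genus D'.

(** A coloring of the regions, given on the sides of the arcs; [true] is black. *)
Definition coloring (D : gauss_diagram) : Type := side D -> bool.

Definition checkerboard (D : gauss_diagram) (xi : coloring D) : Prop :=
  (forall s t : side D, region_of s = region_of t -> xi s = xi t) /\
  (forall a : arc D, xi (a, true) != xi (a, false)).

Definition dual (D : gauss_diagram) (xi : coloring D) : coloring D :=
  fun s => ~~ xi s.

(** The complex eigenvalues, with algebraic multiplicity; they are real when [M] is
    real symmetric, and [<] on [algC] only relates numbers whose difference is real. *)
Definition eigenvalues (m : nat) (M : 'M[algC]_m) : seq algC :=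
  sval (closed_field_poly_normal (char_poly M)).

Definition sig (m : nat) (M : 'M[int]_m) : int :=
  let ev := eigenvalues (map_mx intr M) in
  (count (fun x => 0 < x) ev)%:Z - (count (fun x => x < 0) ev)%:Z.

Section Signature.
Variables (D : gauss_diagram) (xi : coloring D).

Definition writhe (k : 'I_(len D)) : int := if positive (passage_at k) then 1 else -1.

(** Rotating the over-strand counterclockwise to the under-strand sweeps out the
    local regions that follow its two half-edges counterclockwise. *)
Definition incidence (k : 'I_(len D)) : int :=
  if xi (ccw_side (k, true)) && xi (ccw_side (k, false)) then 1 else -1.

Definition type_II (k : 'I_(len D)) : bool := writhe k * incidence k == 1.

(** One of the four local regions at the crossing belongs to [X]. *)
Definition adjacent (k : 'I_(len D)) (X : {set side D}) : bool :=
  [exists o : bool, (ccw_side (k, o) \in X) || (ccw_side (partner k, o) \in X)].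

Definition white_regions : {set {set side D}} :=
  [set X in regions D | [forall s in X, ~~ xi s]].

Definition goeritz_off (X Y : {set side D}) : int :=
  - \sum_(k in crossings D | adjacent k X && adjacent k Y) incidence k.

Definition goeritz_entry (X Y : {set side D}) : int :=
  if X == Y then - \sum_(Z in white_regions | Z != X) goeritz_off X Z
  else goeritz_off X Y.

(** The white regions X_0, ..., X_m in the order of [enum]; the matrix omits X_0. *)
Definition white_region (i : nat) : {set side D} := nth set0 (enum white_regions) i.

Definition goeritz : 'M[int]_(#|white_regions|.-1) :=
  \matrix_(i, j) goeritz_entry (white_region i.+1) (white_region j.+1).

Definition correction : int := \sum_(k in crossings D | type_II k) incidence k.

Definition sigma : int := sig goeritz - correction.

End Signature.

(** [knot_signatures xi p]: the knot represented by [D] has, computed from the minimal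
    genus diagram [D], the signatures (sigma_xi, sigma_(dual xi)) = [p]. *)
Definition knot_signatures (D : gauss_diagram) (xi : coloring D) (p : int * int) : Prop :=
  [/\ minimal_genus D, checkerboard xi & (sigma xi, sigma (dual xi)) = p].

Definition crossing_change (p : passage) : passage := (label p, ~~ over p, ~~ positive p).
Definition sign_change (p : passage) : passage := (label p, over p, ~~ positive p).

Lemma rev_code_valid D : valid_code (rev_tuple (code D)).
Proof.
have /andP[uD /allP oD] := codeP D.
rewrite /valid_code /= map_rev rev_uniq uD /=.
by apply/allP => p; rewrite !mem_rev; apply: oD.
Qed.

Lemma crossing_change_code_valid D :
  valid_code (map_tuple crossing_change (code D)).
Proof.
have /andP[uD /allP oD] := codeP D.
apply/andP; split=> /=.
- rewrite -map_comp (eq_map (g := (fun q : nat * bool => (q.1, ~~ q.2)) \o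
    (fun p => (label p, over p)))) // map_comp map_inj_uniq //.
  by move=> [a b] [c d] /= [-> /negb_inj ->].
- apply/allP => _ /mapP[p /oD op ->].
  by apply/mapP; exists (opposite p).
Qed.

Lemma sign_change_code_valid D : valid_code (map_tuple sign_change (code D)).
Proof.
have /andP[uD /allP oD] := codeP D.
apply/andP; split=> /=.
- by rewrite -map_comp (eq_map (g := fun p => (label p, over p))).
- apply/allP => _ /mapP[p /oD op ->].
  by apply/mapP; exists (opposite p).
Qed.

Arguments knot_signatures D xi p : clear implicits.

(** -D *)
Definition inverse (D : gauss_diagram) : gauss_diagram :=
  GaussDiagram (rev_code_valid D).

(** D^* : cc at every crossing. *)
Definition vertical_mirror (D : gauss_diagram) : gauss_diagram :=
  GaussDiagram (crossing_change_code_valid D).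

(** D^dag : sc at every crossing. *)
Definition horizontal_mirror (D : gauss_diagram) : gauss_diagram :=
  GaussDiagram (sign_change_code_valid D).

(** Induced colorings.  Arc [a] of -D is arc [rev_ord (ordS a)] of D traversed
    backwards; the arcs of the mirror images have the same indices, orientations and
    left sides as those of D. *)
Definition inverse_coloring (D : gauss_diagram) (xi : coloring D) :
    coloring (inverse D) :=
  fun s : side D => xi (rev_ord (ordS s.1), ~~ s.2).

Definition vertical_coloring (D : gauss_diagram) (xi : coloring D) :
    coloring (vertical_mirror D) := xi.

Definition horizontal_coloring (D : gauss_diagram) (xi : coloring D) :
    coloring (horizontal_mirror D) := xi.

(* Main.v *)
Require Import Defs.
From mathcomp Require Import all_boot all_order all_algebra all_field.
From Stdlib Require Import Relation_Operators.
From mathcomp Require Import perm.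
Import GRing.Theory.
Local Open Scope ring_scope.

(** Each operation induces a bijection between the sides of the arcs of the two diagrams that
    respects the regions.  Under it the incidence numbers and the writhes are both
    preserved or both negated, hence so are the entries of the Goeritz matrix and the
    correction term; the reflection also turns white regions into black ones.  The
    enumeration of the white regions, hence the region omitted from the Goeritz matrix,
    is not preserved.  This is harmless: the full Laplacian matrix is congruent to the
    direct sum of 0 and any of its reduced matrices, so by Sylvester's law of inertia
    the signature does not depend on the omitted region.  Minimality of the genus
    follows because the operations are involutions that preserve the genus and carry
    Reidemeister moves to Reidemeister moves, up to a change of base point. *)

Set Implicit Arguments.
Unset Strict Implicit.
Unset Printing Implicit Defensive.
Import Defs Order.TTheory GRing.Theory Num.Theory.

(** * Signatures of integral symmetric matrices *)

Local Open Scope sesquilinear_scope.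

Lemma char_poly_conjugate (F : fieldType) (n : nat) (P A : 'M[F]_n) :
  P \in unitmx -> char_poly (invmx P *m A *m P) = char_poly A.
Proof.
move=> uP.
have E : char_poly_mx (invmx P *m A *m P)
    = map_mx polyC (invmx P) *m char_poly_mx A *m map_mx polyC P.
  rewrite /char_poly_mx mulmxBr mulmxBl !map_mxM; congr (_ - _).
  by rewrite mul_mx_scalar -scalemxAl -map_mxM mulVmx // map_mx1 scalemx1.
rewrite /char_poly {}E !det_mulmx !det_map_mx mulrAC -polyCM -det_mulmx mulVmx //.
by rewrite det1 mul1r.
Qed.

Lemma perm_eigenvalues (n : nat) (M : 'M[algC]_n) (s : seq algC) :
  char_poly M = \prod_(x <- s) ('X - x%:P) -> perm_eq (eigenvalues M) s.
Proof.
move=> Ms; rewrite /eigenvalues.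
case: closed_field_poly_normal => r /= Mr; apply: prod_XsubC_eq.
by rewrite -Ms Mr (monicP (char_poly_monic M)) scale1r.
Qed.

Lemma eigenvalues_diag (n : nat) (P : 'M[algC]_n) (d : 'rV[algC]_n) :
  P \in unitmx ->
  perm_eq (eigenvalues (invmx P *m diag_mx d *m P)) [seq d 0 i | i : 'I_n].
Proof.
move=> uP; apply: perm_eigenvalues; rewrite char_poly_conjugate //.
rewrite char_poly_trig ?diag_mx_is_trig // big_image /=.
by apply: eq_bigr => i _; rewrite mxE eqxx.
Qed.

(** On the span of the coordinate vectors with [0 < e 0 i] the form [e] is positive definite, so [Q]
    sends no nonzero vector of it to where [d] is nonpositive. Hence the minor of [Q] between the
    two sets of positive indices has independent rows. *)
Lemma inertia_le (n : nat) (d e : 'rV[algC]_n) (Q : 'M[algC]_n) :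
  d \is a mxOver Num.real -> diag_mx e = Q *m diag_mx d *m Q^t* ->
  (#|[pred i | (0 < e 0 i)%R]| <= #|[pred i | (0 < d 0 i)%R]|)%N.
Proof.
move=> dR eQ.
pose f (i : 'I_#|[pred i | (0 < e 0 i)%R]|) := enum_val i.
pose g (i : 'I_#|[pred i | (0 < d 0 i)%R]|) := enum_val i.
suff : row_free (mxsub f g Q).
  by rewrite -row_leq_rank => /leq_trans; apply; apply: rank_leq_col.
apply: inj_row_free => x xN.
(* [u] is [x] extended by zero; [xN] says that [u *m Q] vanishes at the positive entries of [d]. *)
pose u := x *m rowsub f 1%:M.
have diagE (a v : 'rV[algC]_n) :
    (v *m diag_mx a *m v^t*) 0 0 = \sum_j `|v 0 j| ^+ 2 * a 0 j.
  rewrite mxE; apply: eq_bigr => j _.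
  by rewrite mul_mx_diag !mxE normCK mulrAC.
have uf i : u 0 (f i) = x 0 i.
  rewrite mxE (bigD1 i) //= !mxE eqxx mulr1 big1 ?addr0 // => j ji.
  by rewrite !mxE (inj_eq enum_val_inj) (negPf ji) mulr0.
have u0 j : ~~ (0 < e 0 j) -> u 0 j = 0.
  move=> ej; rewrite mxE big1 // => i _; rewrite !mxE.
  case: eqP => [fij|]; last by rewrite mulr0.
  by move: (enum_valP i); rewrite inE -/(f i) fij (negPf ej).
have uQ0 j : 0 < d 0 j -> (u *m Q) 0 j = 0.
  move=> dj; have jP : j \in [pred i | (0 < d 0 i)%R] by rewrite inE.
  have /rowP/(_ (enum_rank_in jP j)) := xN.
  rewrite /u -mulmxA mul_rowsub_mx mul1mx.
  rewrite [RHS]mxE; apply: etrans; rewrite !mxE; apply: eq_bigr => i _.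
  by rewrite !mxE /g enum_rankK_in.
have pos j : 0 <= `|u 0 j| ^+ 2 * e 0 j.
  have [/ltW ej|/u0 ->] := boolP (0 < e 0 j); first by rewrite mulr_ge0 ?exprn_ge0.
  by rewrite normr0 expr0n mul0r.
(* The value of [e] at [u] is that of [d] at [u *m Q], where only nonpositive entries of [d]
   contribute. *)
have: \sum_j `|u 0 j| ^+ 2 * e 0 j <= 0.
  rewrite -diagE eQ.
  have -> : u *m (Q *m diag_mx d *m Q^t*) *m u^t*
     = (u *m Q) *m diag_mx d *m (u *m Q)^t*.
    by rewrite [(u *m Q)^T]trmx_mul map_mxM !mulmxA.
  rewrite diagE -oppr_ge0 -sumrN; apply: sumr_ge0 => j _.
  rewrite -mulrN; have [/uQ0 ->|dj] := boolP (0 < d 0 j).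
    by rewrite normr0 expr0n mul0r.
  apply: mulr_ge0; rewrite ?exprn_ge0 // oppr_ge0 real_leNgt //.
  by apply: (mxOverP dR).
move=> u_le0; have /eqP : \sum_j `|u 0 j| ^+ 2 * e 0 j = 0.
  by apply: le_anti; rewrite u_le0 sumr_ge0.
rewrite psumr_eq0 // => /allP u_0.
apply/rowP => i; rewrite [RHS]mxE -uf.
have := u_0 (f i) (mem_index_enum _).
have ei : 0 < e 0 (f i) by move: (enum_valP i); rewrite inE.
by rewrite /= mulf_eq0 (gt_eqF ei) orbF sqrf_eq0 normr_eq0 => /eqP.
Qed.

Lemma symmetric_spectral (n : nat) (M : 'M[int]_n) : M^T = M ->
  exists (P : 'M[algC]_n) (d : 'rV[algC]_n),
    [/\ P \is unitarymx, d \is a mxOver Num.real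
      & map_mx intr M = invmx P *m diag_mx d *m P].
Proof.
move=> sM; pose A := map_mx (intr : int -> algC) M.
have hA : A \is hermsymmx.
  apply: realsym_hermsym; last first.
    by apply/mxOverP => i j; rewrite mxE realz.
  by apply/is_hermitianmxP; rewrite expr0 scale1r map_mx_id // map_trmx sM.
exists (spectralmx A), (spectral_diag A); split.
- exact: spectral_unitarymx.
- exact: hermitian_spectral_diag_real.
- exact/orthomx_spectralP/hermitian_normalmx.
Qed.

Definition positive_index (n : nat) (M : 'M[int]_n) : nat :=
  count (fun x : algC => 0 < x) (eigenvalues (map_mx intr M)).

Lemma positive_index_diag (n : nat) (M : 'M[int]_n) (P : 'M[algC]_n) d :
  P \in unitmx -> map_mx intr M = invmx P *m diag_mx d *m P ->
  positive_index M = #|[pred i | (0 < d 0 i)%R]|.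
Proof.
move=> uP MP; rewrite /positive_index MP.
rewrite (seq.permP (eigenvalues_diag _ uP)) count_map cardE size_filter.
by rewrite enumT; apply: eq_count.
Qed.

(** Negation exchanges positive and negative eigenvalues, so bounds on positive indices will suffice
    for the law of inertia. *)
Lemma sigE (n : nat) (M : 'M[int]_n) : M^T = M ->
  sig M = (positive_index M)%:Z - (positive_index (- M))%:Z.
Proof.
move=> /symmetric_spectral[P [d [/unitarymx_unit uP _ MP]]].
rewrite /sig /positive_index; congr (_ - Posz _).
have NMP : map_mx intr (- M) = invmx P *m diag_mx (- d) *m P.
  by rewrite map_mxN MP linearN mulmxN mulNmx.
rewrite MP NMP !(seq.permP (eigenvalues_diag _ uP)) !count_map.
by apply: eq_count => i /=; rewrite mxE oppr_gt0.
Qed.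

Lemma sigN (n : nat) (M : 'M[int]_n) : M^T = M -> sig (- M) = - sig M.
Proof.
move=> sM; have sNM : (- M)^T = - M by rewrite linearN /= sM.
by rewrite (sigE sM) (sigE sNM) opprK opprB.
Qed.

(** Both matrices are unitarily diagonalizable, which turns the congruence by [Q] into one between
    real diagonal matrices. For a singular [Q] the index can drop. *)
Lemma positive_index_congruent_le (n : nat) (M Q : 'M[int]_n) : M^T = M ->
  (positive_index (Q *m M *m Q^T) <= positive_index M)%N.
Proof.
move=> sM; have [P [d [UP dR MP]]] := symmetric_spectral sM.
have sN : (Q *m M *m Q^T)^T = Q *m M *m Q^T.
  by rewrite !trmx_mul trmxK sM mulmxA.
have [R [e [UR _ NR]]] := symmetric_spectral sN.
have uP := unitarymx_unit UP; have uR := unitarymx_unit UR.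
rewrite (positive_index_diag uP MP) (positive_index_diag uR NR).
pose q := map_mx (intr : int -> algC) Q.
apply: (@inertia_le _ d e (R *m q *m invmx P) dR).
have qC : q^t* = q^T by apply/matrixP => i j; rewrite !mxE conj_intr.
have -> : (R *m q *m invmx P)^t* = P *m q^T *m invmx R.
  have PC : (invmx P)^t* = P by rewrite invmx_unitary // trmxCK.
  by rewrite !trmx_mul !map_mxM /= PC qC -invmx_unitary // mulmxA.
have := NR; rewrite !map_mxM /= MP map_trmx -/q.
move=> /(congr1 (fun X => R *m X *m invmx R)).
by rewrite !mulmxA mulmxV // mul1mx mulmxK // => <-; rewrite !mulmxA.
Qed.

(** Sylvester's law: the inequality of positive indices is applied to [Q] and to its inverse, for
    [M] and for [- M]. *)
Lemma sig_congruent (n : nat) (M Q : 'M[int]_n) :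
  M^T = M -> Q \in unitmx -> sig (Q *m M *m Q^T) = sig M.
Proof.
move=> sM uQ.
have sN : (Q *m M *m Q^T)^T = Q *m M *m Q^T.
  by rewrite !trmx_mul trmxK sM mulmxA.
have pos_eq (A : 'M[int]_n) : A^T = A ->
    positive_index (Q *m A *m Q^T) = positive_index A.
  move=> sA; apply/eqP; rewrite eqn_leq positive_index_congruent_le //=.
  have {1}-> : A = invmx Q *m (Q *m A *m Q^T) *m (invmx Q)^T.
    by rewrite !mulmxA mulVmx // mul1mx -mulmxA -trmx_mul mulVmx // trmx1 mulmx1.
  by apply: positive_index_congruent_le; rewrite !trmx_mul trmxK sA mulmxA.
have sNM : (- M)^T = - M by rewrite linearN /= sM.
by rewrite (sigE sN) (sigE sM) -mulNmx -mulmxN !pos_eq.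
Qed.

Lemma sig_block_diag0 (n : nat) (M : 'M[int]_n) :
  sig (block_mx (0 : 'M_1) 0 0 M) = sig M.
Proof.
have [r rE] : {r | char_poly (map_mx (intr : int -> algC) M)
    = \prod_(x <- r) ('X - x%:P)}.
  exists (eigenvalues (map_mx intr M)); rewrite /eigenvalues.
  case: closed_field_poly_normal => r /= {1}->.
  by rewrite (monicP (char_poly_monic _)) scale1r.
have : perm_eq (eigenvalues (map_mx intr (block_mx (0 : 'M_1) 0 0 M))) (0 :: r).
  apply: perm_eigenvalues; rewrite map_block_mx !map_mx0 /char_poly.
  rewrite char_block_diag_mx det_ublock big_cons -rE; congr (_ * _).
  by rewrite det_mx11 !mxE eqxx.
by move=> /seq.permP h; rewrite /sig !h !(seq.permP (perm_eigenvalues rE)) /= ltxx.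
Qed.

(** Adding all other rows to the first, and then likewise the columns, is a unimodular congruence.
    As row and column sums vanish, it clears the first row and column and leaves the minor
    intact. *)
Lemma sig_laplacian_minor (m : nat) (L : 'M[int]_(1 + m)) : L^T = L ->
  L *m const_mx 1 = 0 :> 'cV_(1 + m) -> sig (drsubmx L) = sig L.
Proof.
move=> sL L1.
pose P : 'M[int]_(1 + m) := block_mx 1%:M (const_mx 1) 0 1%:M.
have uP : P \in unitmx by rewrite unitmxE det_ublock !det1 mulr1 unitr1.
rewrite -(sig_congruent sL uP) -sig_block_diag0; congr sig.
move: sL L1; rewrite -[L]submxK tr_block_mx.
set a := ulsubmx L; set b := ursubmx L; set c := dlsubmx L; set d := drsubmx L.
move=> /eq_block_mx[aa cb bc dd].
have -> : const_mx 1 = col_mx (const_mx 1) (const_mx 1) :> 'cV[int]_(1 + m).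
  by rewrite col_mx_const.
have one : const_mx 1 = 1%:M :> 'M[int]_1.
  by apply/matrixP => i j; rewrite !mxE !ord1.
rewrite mul_block_col -[RHS]vsubmxK !raddf0 one !mulmx1 => /eq_col_mx[ab0 cd0].
(* By symmetry of [L] the transposed row relations say that the column sums vanish too. *)
have ac0 : a + const_mx 1 *m c = 0.
  by apply: trmx_inj; rewrite trmx0 linearD /= aa trmx_mul trmx_const cb.
have bd0 : b + const_mx 1 *m d = 0.
  by apply: trmx_inj; rewrite trmx0 linearD /= bc trmx_mul trmx_const dd.
rewrite /P tr_block_mx !mulmx_block.
rewrite !trmx0 !trmx1 trmx_const !mul1mx !mul0mx !add0r !mulmx0 !mulmx1.
by rewrite ac0 bd0 cd0 mul0mx !add0r block_mxKdr.
Qed.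

(** Either reduced matrix has the signature of its full matrix, and the full matrices are congruent
    by a permutation matrix. The index [i.+1] skips the first entry of the list. *)
Lemma sig_laplacian_perm (T : eqType) (x0 : T) (g : T -> T -> int)
    (s t : seq T) (m n : nat) :
  {in s &, forall x y, g x y = g y x} ->
  {in s, forall x, \sum_(y <- s) g x y = 0} ->
  perm_eq s t -> size s = m -> size t = n ->
  sig (\matrix_(i < m.-1, j < m.-1) g (nth x0 s i.+1) (nth x0 s j.+1)) =
  sig (\matrix_(i < n.-1, j < n.-1) g (nth x0 t i.+1) (nth x0 t j.+1)).
Proof.
move=> gC g0 st sm; rewrite -{1}(perm_size st) sm => <- {n}.
have tn : size t = m by rewrite -(perm_size st).
pose full r : 'M[int]_m := \matrix_(i, j) g (nth x0 r i) (nth x0 r j).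
have sym_full r : size r = m -> {in r &, forall x y, g x y = g y x} ->
    (full r)^T = full r.
  by move=> rn rC; apply/matrixP => i j; rewrite !mxE rC ?mem_nth ?rn.
have minor r : size r = m -> {in r &, forall x y, g x y = g y x} ->
    {in r, forall x, \sum_(y <- r) g x y = 0} ->
    sig (\matrix_(i < m.-1, j < m.-1) g (nth x0 r i.+1) (nth x0 r j.+1))
    = sig (full r).
  move: @full sym_full; clear sm tn; case: m => [|k] full sym_full rn rC r0.
    (* For the empty list both matrices have size 0, as [0.-1] is 0. *)
    by congr sig; apply/matrixP => -[].
  rewrite -(@sig_laplacian_minor k (full r)).
  - by congr sig; apply/matrixP => i j; rewrite !mxE.
  - exact: sym_full.
  - apply/matrixP => i j; rewrite !mxE.
    have ri : nth x0 r i \in r by rewrite mem_nth // rn.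
    have := r0 _ ri; rewrite (big_nth x0) rn big_mkord; apply: etrans.
    by apply: eq_bigr => l _; rewrite !mxE mulr1.
have gC' : {in t &, forall x y, g x y = g y x}.
  by move=> x y; rewrite -!(perm_mem st); apply: gC.
have g0' : {in t, forall x, \sum_(y <- t) g x y = 0}.
  by move=> x; rewrite -!(perm_mem st) -(perm_big _ st); apply: g0.
rewrite !minor //.
have /tuple_permP[p tE] : perm_eq t (Tuple (introT eqP sm)) by rewrite perm_sym.
have uP : perm_mx p \in unitmx := unitmx_perm int p.
rewrite -(sig_congruent (sym_full s sm gC) uP).
rewrite tr_perm_mx -row_permE -col_permE.
congr sig; apply/matrixP => i j; rewrite !mxE.
by rewrite tE !nth_mktuple !(tnth_nth x0).
Qed.

Local Close Scope sesquilinear_scope.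

(** * Reidemeister moves on transformed diagrams *)

Lemma valid_code_catC (u v : seq passage) : valid_code (u ++ v) = valid_code (v ++ u).
Proof.
have uv : perm_eq (u ++ v) (v ++ u) by rewrite perm_catC.
rewrite /valid_code (perm_uniq (perm_map _ uv)) (perm_all _ uv); congr (_ && _).
by apply: eq_all => p; rewrite (perm_mem uv).
Qed.

Definition diagram_of (w : seq passage) (wV : valid_code w) : gauss_diagram :=
  @GaussDiagram _ (in_tuple w) wV.

Lemma same_knot_code (D D' : gauss_diagram) :
  code D = code D' :> seq passage -> same_knot D D'.
Proof.
move=> DD'; apply: rst_step; rewrite /step DD' -{1}[tval (code D')]cats0.
exact: (MoveRotate _ [::]).
Qed.

(** Validity is invariant under rotation, so the rotated words are diagrams through which the
    equivalence can pass. *)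
Lemma same_knot_rotated_move (D D' : gauss_diagram) (u v u' v' : seq passage) :
  code D = u ++ v :> seq passage -> code D' = u' ++ v' :> seq passage ->
  move (v ++ u) (v' ++ u') -> same_knot D D'.
Proof.
move=> Duv Duv' vu.
have V : valid_code (v ++ u) by rewrite valid_code_catC -Duv; apply: codeP.
have V' : valid_code (v' ++ u') by rewrite valid_code_catC -Duv'; apply: codeP.
apply: rst_trans (rst_trans _ _ (diagram_of V) (diagram_of V') _ _ _) => //.
- by apply: rst_step; rewrite /step Duv; apply: MoveRotate.
- exact: rst_step.
- by apply: rst_step; rewrite /step Duv'; apply: MoveRotate.
Qed.

(** The first two Reidemeister moves insert passages at the start of the word, and the third has its
    top strand there. An operation may displace these, hence the free base points before and after
    the move. *)
Definition move_up_to_rotation (w w' : seq passage) : Prop :=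
  exists u v u' v', [/\ w = u ++ v, w' = u' ++ v' & move (v ++ u) (v' ++ u')].

Lemma move_no_rotation (w w' : seq passage) : move w w' -> move_up_to_rotation w w'.
Proof. by exists [::], w, [::], w'; rewrite !cats0. Qed.

(** A competitor [D'] of [op D] yields the competitor [op D'] of [op (op D)], which has the code of
    [D]; [op] changes none of the genera. *)
Lemma minimal_genus_transform (op : gauss_diagram -> gauss_diagram)
    (F : seq passage -> seq passage) :
  (forall D, code (op D) = F (code D) :> seq passage) -> involutive F ->
  (forall w w', move w w' -> move_up_to_rotation (F w) (F w')) ->
  (forall D, supporting_genus (op D) = supporting_genus D) ->
  forall D, minimal_genus D -> minimal_genus (op D).
Proof.
move=> opE FK Fmove genus_op D Dmin D' DD'.
have op_knot E E' : same_knot E E' -> same_knot (op E) (op E').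
  elim=> [{}E {}E' /Fmove [u [v [u' [v' [Eu Eu' uv]]]]]
         |{}E|{}E {}E' _|{}E E1 {}E' _ EE1 _].
  - by apply: same_knot_rotated_move uv; rewrite opE.
  - exact: rst_refl.
  - exact: rst_sym.
  - exact: rst_trans.
rewrite genus_op -(genus_op D'); apply: Dmin.
apply: rst_trans (op_knot _ _ DD'); apply: same_knot_code.
by rewrite !opE FK.
Qed.

Lemma crossing_changeK : involutive crossing_change.
Proof. by move=> [[a o] e]; rewrite /crossing_change /= !negbK. Qed.

Lemma sign_changeK : involutive sign_change.
Proof. by move=> [[a o] e]; rewrite /sign_change /= !negbK. Qed.

Lemma map_rename_commute (g : passage -> passage) f w :
  (forall p, g (rename f p) = rename f (g p)) ->
  map g (map (rename f) w) = map (rename f) (map g w).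
Proof. by move=> gf; rewrite -!map_comp; apply: eq_map. Qed.

Section Strands.
Variables (a b c : nat) (ea eb ec d : bool).

(** Reversal keeps the three signs but reverses the order on every strand, which is the effect of
    negating [d]. *)
Lemma rev_top : rev (top_strand a b ea eb d) = top_strand a b ea eb (~~ d).
Proof. by case: d; case: eb. Qed.

Lemma rev_middle : rev (middle_strand a c ea ec d) = middle_strand a c ea ec (~~ d).
Proof. by case: d; case: ec. Qed.

Lemma rev_bottom :
  rev (bottom_strand b c ea eb ec d) = bottom_strand b c ea eb ec (~~ d).
Proof. by case: d; case: ea; case: eb; case: ec. Qed.

(** The order on each strand is fixed by a product of an even number of the signs [d], [ea], [eb],
    [ec], so negating all four preserves it. *)
Lemma sign_change_top :
  map sign_change (top_strand a b ea eb d) = top_strand a b (~~ ea) (~~ eb) (~~ d).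
Proof. by case: d; case: eb. Qed.

Lemma sign_change_middle : map sign_change (middle_strand a c ea ec d)
  = middle_strand a c (~~ ea) (~~ ec) (~~ d).
Proof. by case: d; case: ec. Qed.

Lemma sign_change_bottom : map sign_change (bottom_strand b c ea eb ec d)
  = bottom_strand b c (~~ ea) (~~ eb) (~~ ec) (~~ d).
Proof. by case: d; case: ea; case: eb; case: ec. Qed.

(* Changing all crossings makes the bottom strand the top one, so that the crossings
   [a] and [c] trade places. *)
Lemma crossing_change_top : map crossing_change (top_strand a b ea eb d)
  = bottom_strand b a (~~ ec) (~~ eb) (~~ ea) (d (+) ea (+) ec).
Proof. by case: d; case: ea; case: eb; case: ec. Qed.

Lemma crossing_change_middle : map crossing_change (middle_strand a c ea ec d)
  = middle_strand c a (~~ ec) (~~ ea) (d (+) ea (+) ec).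
Proof. by case: d; case: ea; case: ec. Qed.

Lemma crossing_change_bottom : map crossing_change (bottom_strand b c ea eb ec d)
  = top_strand c b (~~ ec) (~~ eb) (d (+) ea (+) ec).
Proof. by case: d; case: ea; case: eb; case: ec. Qed.

End Strands.

(** Passages at the start of a word move to the end of its reversal, and a rotation brings them
    back. In the third move the cyclic order of the middle and bottom strands is also exchanged. *)
Lemma rev_move (w w' : seq passage) : move w w' -> move_up_to_rotation (rev w) (rev w').
Proof.
case=> {w w'} [u v|f w fI|a o e w|a b o e u v|a b o e u v
              |a b c ea eb ec d u v w|a b c ea eb ec d u v w].
- by apply: move_no_rotation; rewrite !rev_cat; apply: MoveRotate.
- by apply: move_no_rotation; rewrite -map_rev; apply: MoveRename.
- exists [::], (rev w), (rev w), [:: (a, ~~ o, e); (a, o, e)].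
  by rewrite cats0 rev_cat; split=> //; have := Move1 a (~~ o) e (rev w); rewrite negbK.
- exists (rev v), (rev u), (rev v),
    ([:: (b, ~~ o, ~~ e); (a, ~~ o, e)] ++ rev u ++ [:: (b, o, ~~ e); (a, o, e)]).
  rewrite !rev_cat -!catA; split=> //.
  by have := Move2Parallel b a (~~ o) (~~ e) (rev u) (rev v); rewrite !negbK.
- exists (rev v), (rev u), (rev v),
    ([:: (a, ~~ o, e); (b, ~~ o, ~~ e)] ++ rev u ++ [:: (b, o, ~~ e); (a, o, e)]).
  rewrite !rev_cat -!catA; split=> //.
  by have := Move2Antiparallel a b (~~ o) e (rev u) (rev v); rewrite !negbK.
- exists (rev w ++ bottom_strand b c ea eb ec (~~ d) ++ rev v
    ++ middle_strand a c ea ec (~~ d) ++ rev u), (top_strand a b ea eb (~~ d)),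
    (rev w ++ bottom_strand b c ea eb ec (~~ ~~ d) ++ rev v
    ++ middle_strand a c ea ec (~~ ~~ d) ++ rev u), (top_strand a b ea eb (~~ ~~ d)).
  rewrite !rev_cat -!catA !rev_top !rev_middle !rev_bottom; split=> //.
  exact: Move3TopBottomMiddle.
- exists (rev w ++ middle_strand a c ea ec (~~ d) ++ rev v
    ++ bottom_strand b c ea eb ec (~~ d) ++ rev u), (top_strand a b ea eb (~~ d)),
    (rev w ++ middle_strand a c ea ec (~~ ~~ d) ++ rev v
    ++ bottom_strand b c ea eb ec (~~ ~~ d) ++ rev u), (top_strand a b ea eb (~~ ~~ d)).
  rewrite !rev_cat -!catA !rev_top !rev_middle !rev_bottom; split=> //.
  exact: Move3TopMiddleBottom.
Qed.

Lemma sign_change_move (w w' : seq passage) : move w w' ->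
  move_up_to_rotation (map sign_change w) (map sign_change w').
Proof.
move=> ww'; apply: move_no_rotation.
case: ww' => {w w'} [u v|f w fI|a o e w|a b o e u v|a b o e u v
                    |a b c ea eb ec d u v w|a b c ea eb ec d u v w].
- by rewrite !map_cat; apply: MoveRotate.
- by rewrite map_rename_commute //; apply: MoveRename.
- exact: Move1.
- by rewrite !map_cat; apply: (Move2Parallel a b o (~~ e)).
- by rewrite !map_cat; apply: (Move2Antiparallel a b o (~~ e)).
- rewrite !map_cat !sign_change_top !sign_change_middle !sign_change_bottom.
  exact: Move3TopMiddleBottom.
- rewrite !map_cat !sign_change_top !sign_change_middle !sign_change_bottom.
  exact: Move3TopBottomMiddle.
Qed.

Lemma crossing_change_move (w w' : seq passage) : move w w' ->
  move_up_to_rotation (map crossing_change w) (map crossing_change w').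
Proof.
case=> {w w'} [u v|f w fI|a o e w|a b o e u v|a b o e u v
              |a b c ea eb ec d u v w|a b c ea eb ec d u v w].
- by apply: move_no_rotation; rewrite !map_cat; apply: MoveRotate.
- by apply: move_no_rotation; rewrite map_rename_commute //; apply: MoveRename.
- by apply: move_no_rotation; apply: Move1.
- by apply: move_no_rotation; rewrite !map_cat; apply: (Move2Parallel a b (~~ o) (~~ e)).
- apply: move_no_rotation; rewrite !map_cat.
  exact: (Move2Antiparallel a b (~~ o) (~~ e)).
(* The former bottom strand is now on top and the base point moves to it, so that the order top,
   middle, bottom becomes top, bottom, middle. [ec] is supplied because it does not occur on the old
   top strand. *)
- rewrite !map_cat !(crossing_change_top _ _ _ _ ec).
  rewrite !crossing_change_middle !crossing_change_bottom !addNb.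
  set d' := d (+) ea (+) ec; pose cc := map crossing_change.
  exists (bottom_strand b a (~~ ec) (~~ eb) (~~ ea) d' ++ cc u
      ++ middle_strand c a (~~ ec) (~~ ea) d' ++ cc v),
    (top_strand c b (~~ ec) (~~ eb) d' ++ cc w),
    (bottom_strand b a (~~ ec) (~~ eb) (~~ ea) (~~ d') ++ cc u
      ++ middle_strand c a (~~ ec) (~~ ea) (~~ d') ++ cc v),
    (top_strand c b (~~ ec) (~~ eb) (~~ d') ++ cc w).
  by rewrite -!catA; split=> //; apply: Move3TopBottomMiddle.
- rewrite !map_cat !(crossing_change_top _ _ _ _ ec).
  rewrite !crossing_change_middle !crossing_change_bottom !addNb.
  set d' := d (+) ea (+) ec; pose cc := map crossing_change.
  exists (bottom_strand b a (~~ ec) (~~ eb) (~~ ea) d' ++ cc u),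
    (top_strand c b (~~ ec) (~~ eb) d' ++ cc v
      ++ middle_strand c a (~~ ec) (~~ ea) d' ++ cc w),
    (bottom_strand b a (~~ ec) (~~ eb) (~~ ea) (~~ d') ++ cc u),
    (top_strand c b (~~ ec) (~~ eb) (~~ d') ++ cc v
      ++ middle_strand c a (~~ ec) (~~ ea) (~~ d') ++ cc w).
  by rewrite -!catA; split=> //; apply: Move3TopMiddleBottom.
Qed.

(** * Regions and crossings *)

Definition other_side (D : gauss_diagram) (s : side D) : side D := (s.1, ~~ s.2).

Lemma other_sideK (D : gauss_diagram) : involutive (@other_side D).
Proof. by move=> [a b]; rewrite /other_side /= negbK. Qed.

Lemma connect_homo (T U : finType) (e : rel T) (e' : rel U) (f : T -> U) :
  {homo f : s t / e s t >-> e' s t} ->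
  {homo f : s t / connect e s t >-> connect e' s t}.
Proof.
move=> fe s t /connectP[p ep ->]; elim: p s ep => [|r p IHp] s //=.
by case/andP=> sr rp; apply: connect_trans (connect1 (fe _ _ sr)) (IHp _ rp).
Qed.

Section Crossings.
Variable D : gauss_diagram.
Implicit Types (k j : 'I_(len D)) (h : half_edge D) (s t : side D).

Lemma passage_at_inj k j : label (passage_at k) = label (passage_at j) ->
  over (passage_at k) = over (passage_at j) -> k = j.
Proof.
move=> lkj okj; have /andP[uD _] := codeP D.
have szD := size_tuple (code D); pose p0 : passage := passage_at k.
apply: ord_inj; apply/eqP.
rewrite -(nth_uniq (label p0, over p0) _ _ uD) ?size_map ?szD //.
rewrite !(nth_map p0) ?szD //.
by move: lkj okj; rewrite /passage_at !(tnth_nth p0) => -> ->.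
Qed.

(** Validity puts the opposite passage into the code, and the uniqueness of label and over flag
    makes it the only other passage of the crossing, so [pick] finds exactly it. *)
Lemma partnerP k : [/\ label (passage_at (partner k)) = label (passage_at k),
  over (passage_at (partner k)) = ~~ over (passage_at k),
  positive (passage_at (partner k)) = positive (passage_at k)
  & forall j, label (passage_at j) = label (passage_at k) -> j != k -> partner k = j].
Proof.
have /andP[_ /allP/(_ _ (mem_tnth k (code D)))] := codeP D.
rewrite -/(passage_at k) => /tnthP[j]; rewrite -/(passage_at j) => kj.
have uniq_j i : label (passage_at i) = label (passage_at k) -> i != k -> i = j.
  move=> lik ik; apply: passage_at_inj; rewrite -kj ?lik //=.
  have [oik|] := eqVneq (over (passage_at i)) (over (passage_at k)).
    by rewrite (passage_at_inj lik oik) eqxx in ik.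
  rewrite [over (opposite _)]/(~~ over (passage_at k)).
  by case: (over (passage_at i)); case: (over (passage_at k)).
have jk : j != k.
  apply/eqP => jk; move: kj; rewrite jk => /(congr1 over).
  by rewrite [over (opposite _)]/(~~ over (passage_at k)); case: (over _).
rewrite /partner; case: pickP => [i /andP[/eqP lik ik]|/(_ j)] /=; last first.
  by rewrite -kj eqxx jk.
rewrite (uniq_j i) // -kj; split=> // i' li' ik'.
by rewrite (uniq_j i') //.
Qed.
Lemma label_partner k : label (passage_at (partner k)) = label (passage_at k).
Proof. by have [] := partnerP k. Qed.

Lemma over_partner k : over (passage_at (partner k)) = ~~ over (passage_at k).
Proof. by have [] := partnerP k. Qed.

Lemma positive_partner k :
  positive (passage_at (partner k)) = positive (passage_at k).
Proof. by have [] := partnerP k. Qed.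

Lemma partner_unique k j :
  label (passage_at j) = label (passage_at k) -> j != k -> partner k = j.
Proof. by have [_ _ _] := partnerP k; apply. Qed.

Lemma partner_neq k : partner k != k.
Proof.
by apply/eqP => pk; have := over_partner k; rewrite pk; case: (over _).
Qed.

Lemma partnerK : involutive (@partner D).
Proof.
by move=> k; apply: partner_unique; rewrite ?label_partner // eq_sym partner_neq.
Qed.

(** The two strands alternate around a crossing, so a half turn leads to the other end of the same
    passage. *)
Lemma ccw_next2 h : ccw_next (ccw_next h) = (h.1, ~~ h.2).
Proof.
case: h => k b; rewrite /ccw_next /= partnerK over_partner positive_partner.
by case: (over _); case: (positive _); case: b.
Qed.

Lemma ccw_next4 h : ccw_next (ccw_next (ccw_next (ccw_next h))) = h.
Proof. by rewrite !ccw_next2 /= negbK; case: h. Qed.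

Lemma cw_sideE h : cw_side h = other_side (ccw_side h).
Proof. by []. Qed.

Lemma joinedP s t : reflect
  (exists h, s = ccw_side h /\ t = cw_side (ccw_next h) \/
             t = ccw_side h /\ s = cw_side (ccw_next h))
  (joined s t).
Proof.
apply: (iffP existsP) => -[h].
  by case/orP=> /eqP E; exists h; [left|right];
     split; [exact: (congr1 fst (esym E))|exact: (congr1 snd (esym E))
            |exact: (congr1 fst (esym E))|exact: (congr1 snd (esym E))].
by case=> -[-> ->]; exists h; rewrite eqxx ?orbT.
Qed.

Lemma joined_ccw h : joined (ccw_side h) (cw_side (ccw_next h)).
Proof. by apply/existsP; exists h; rewrite eqxx. Qed.

Lemma joined_sym : symmetric (@joined D).
Proof. by move=> s t; apply: eq_existsb => h; rewrite orbC. Qed.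

Lemma mem_region_of s t : (t \in region_of s) = connect (@joined D) s t.
Proof. by rewrite inE. Qed.

Lemma region_of_eq s t :
  connect (@joined D) s t -> region_of s = region_of t.
Proof.
move=> st; apply/setP => r; rewrite !mem_region_of.
exact: (same_connect (sym_connect_sym joined_sym) st).
Qed.

Lemma region_of_joined s t : joined s t -> region_of s = region_of t.
Proof. by move=> /connect1/region_of_eq. Qed.

Lemma mem_region_joined (X : {set side D}) s t :
  X \in regions D -> joined s t -> (s \in X) = (t \in X).
Proof.
move=> /imsetP[r _ ->] st; rewrite !mem_region_of.
exact: (same_connect1r (sym_connect_sym joined_sym) st).
Qed.

(** Each of the four local regions lies counterclockwise of one half-edge and clockwise of the next.
    A reflection exchanges these two descriptions. *)
Lemma adjacentE k (X : {set side D}) : X \in regions D ->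
  adjacent k X
  = [exists o : bool, (cw_side (k, o) \in X) || (cw_side (partner k, o) \in X)].
Proof.
move=> XD; rewrite /adjacent.
have bE (P : pred bool) : [exists o, P o] = P true || P false.
  by apply/existsP/orP => [[[] Po]|[Po|Po]]; [left|right|exists true|exists false].
rewrite !bE !(mem_region_joined XD (joined_ccw _)) /ccw_next /= partnerK.
rewrite over_partner positive_partner.
by case: (over _); case: (positive _) => /=; do 4!case: (_ \in X).
Qed.

Section Checkerboard.
Variable xi : coloring D.
Hypothesis xiP : checkerboard xi.

Lemma checkerboard_joined s t : joined s t -> xi s = xi t.
Proof. by move=> st; apply: xiP.1; apply: region_of_joined. Qed.

Lemma checkerboard_other s : xi (other_side s) = ~~ xi s.
Proof.
case: s => a b; have := xiP.2 a; rewrite /other_side /=.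
by case: b; case: (xi (a, true)); case: (xi (a, false)).
Qed.

(** Passing a half-edge crosses one arc, so the colors alternate around a crossing. *)
Lemma checkerboard_ccw_next h : xi (ccw_side (ccw_next h)) = ~~ xi (ccw_side h).
Proof.
by rewrite (checkerboard_joined (joined_ccw h)) cw_sideE checkerboard_other negbK.
Qed.

Lemma incidenceE k b : incidence xi k = if xi (ccw_side (k, b)) then 1 else -1.
Proof.
have E : xi (ccw_side (k, true)) = xi (ccw_side (k, false)).
  rewrite -[(k, false)]/((k, true).1, ~~ true) -(ccw_next2 (k, true)).
  by rewrite !checkerboard_ccw_next negbK.
by rewrite /incidence E andbb; case: b; rewrite ?E.
Qed.

(** At the other passage the formula tests the complementary pair of local regions. This is how a
    crossing change acts on incidence numbers. *)
Lemma incidence_partner k : incidence xi (partner k) = - incidence xi k.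
Proof.
have [b bE] : exists b, ccw_next (k, true) = (partner k, b) by eexists.
rewrite (incidenceE _ b) (incidenceE _ true) -bE checkerboard_ccw_next.
by case: (xi _); rewrite ?opprK.
Qed.

Lemma dual_checkerboard : checkerboard (dual xi).
Proof.
split=> [s t /xiP.1 st|a]; first by rewrite /dual st.
by have := xiP.2 a; rewrite /dual; case: (xi _); case: (xi _).
Qed.

Lemma incidence_dual k : incidence (dual xi) k = - incidence xi k.
Proof.
rewrite /incidence; have := incidenceE k true; have := incidenceE k false.
rewrite /incidence /dual.
by case: (xi (ccw_side (k, true))); case: (xi (ccw_side (k, false))).
Qed.

End Checkerboard.
End Crossings.

(** * Transport along a bijection of sides *)

Section Laplacian.
Variables (D : gauss_diagram) (xi : coloring D).

Lemma goeritz_offC (X Y : {set side D}) : goeritz_off xi X Y = goeritz_off xi Y X.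
Proof. by congr (- _); apply: eq_bigl => k; rewrite [X in _ && X]andbC. Qed.

Lemma goeritz_entryC (X Y : {set side D}) :
  goeritz_entry xi X Y = goeritz_entry xi Y X.
Proof.
rewrite /goeritz_entry eq_sym; case: eqP => [->|_] //; exact: goeritz_offC.
Qed.

Lemma goeritz_sym : (goeritz xi)^T = goeritz xi.
Proof. by apply/matrixP => i j; rewrite !mxE goeritz_entryC. Qed.

Lemma goeritz_row_sum (X : {set side D}) : X \in white_regions xi ->
  \sum_(Y <- enum (white_regions xi)) goeritz_entry xi X Y = 0.
Proof.
move=> XW; rewrite big_enum (bigD1 X) //= {1}/goeritz_entry eqxx.
apply/eqP; rewrite addrC subr_eq0; apply/eqP/eq_bigr => Y /andP[_ YX].
by rewrite /goeritz_entry eq_sym (negPf YX).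
Qed.

End Laplacian.

Section Transport.
Variables (D D' : gauss_diagram) (f : side D -> side D').
(** [phi] need not be the map of passages underlying [f]: crossings are indexed by over-passages, so
    a crossing change keeps the sides but exchanges the two passages of each crossing. *)
Variable phi : 'I_(len D) -> 'I_(len D').
Hypothesis f_bij : bijective f.
Hypothesis phi_bij : bijective phi.
Hypothesis f_joined : forall s t, joined (f s) (f t) = joined s t.
Hypothesis f_other : forall s, f (other_side s) = other_side (f s).
Hypothesis phi_over : forall k, over (passage_at (phi k)) = over (passage_at k).

Let f_inj : injective f := bij_inj f_bij.

Lemma region_of_transport s : region_of (f s) = f @: region_of s.
Proof.
have [g fK gK] := f_bij.
apply/setP => t'; rewrite -[t']gK mem_imset // !mem_region_of.
apply/idP/idP => [|/(connect_homo (e' := @joined D'))]; last first.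
  by apply=> u v; rewrite f_joined.
move=> /(connect_homo (f := g) (e' := @joined D)); rewrite !fK; apply.
by move=> u v; rewrite -{1}[u]gK -{1}[v]gK f_joined.
Qed.

Lemma regions_transport : regions D' = [set f @: (X : {set side D}) | X in regions D].
Proof.
have [g fK gK] := f_bij.
apply/setP => X; apply/imsetP/imsetP => [[s _ ->]|[_ /imsetP[s _ ->] ->]].
- exists (region_of (g s)); first exact: imset_f.
  by rewrite -region_of_transport gK.
- by exists (f s); rewrite ?region_of_transport.
Qed.

Lemma card_crossings_transport : #|crossings D'| = #|crossings D|.
Proof.
have [psi phiK psiK] := phi_bij.
rewrite -(card_imset _ (bij_inj phi_bij)); apply: eq_card => k.
by rewrite -[k]psiK mem_imset ?inE ?phi_over //; apply: bij_inj.
Qed.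

Lemma supporting_genus_transport : supporting_genus D' = supporting_genus D.
Proof.
rewrite /supporting_genus /euler_characteristic card_crossings_transport.
by rewrite regions_transport card_imset //; apply: imset_inj.
Qed.

Variables (xi : coloring D) (xi' : coloring D').
Hypothesis xi_f : forall s, xi' (f s) = xi s.
Hypothesis xiP : checkerboard xi.

Lemma checkerboard_transport : checkerboard xi'.
Proof.
have [g fK gK] := f_bij; split=> [s t|a].
  rewrite -[s]gK -[t]gK !region_of_transport !xi_f => /(imset_inj f_inj).
  exact: xiP.1.
rewrite -[(a, false)]/(other_side (a, true)) -[(a, true)]gK -f_other !xi_f.
by rewrite checkerboard_other //; case: (xi _).
Qed.

Lemma white_regions_transport :
  white_regions xi' = [set f @: (X : {set side D}) | X in white_regions xi].
Proof.
have white (X : {set side D}) : [forall s in f @: X, ~~ xi' s] = [forall s in X, ~~ xi s].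
  apply/forall_inP/forall_inP => H s sX; first by rewrite -xi_f H ?imset_f.
  by case/imsetP: sX => t tX ->; rewrite xi_f H.
apply/setP => X; rewrite inE regions_transport.
apply/andP/imsetP => [[/imsetP[Y YD ->]]|[Y]].
  by rewrite white => YW; exists Y; rewrite ?inE ?YD.
by rewrite inE => /andP[YD YW] ->; rewrite white YW imset_f.
Qed.

Variable e : bool.
Hypothesis phi_adjacent : forall k (X : {set side D}), X \in regions D ->
  adjacent (phi k) (f @: X) = adjacent k X.
Hypothesis phi_incidence : forall k, incidence xi' (phi k) = (-1) ^+ e * incidence xi k.
Hypothesis phi_writhe : forall k, writhe (phi k) = (-1) ^+ e * writhe k.

Lemma crossings_sum_transport (P : pred 'I_(len D')) (F : 'I_(len D') -> int) :
  \sum_(k in crossings D' | P k) F k = \sum_(k in crossings D | P (phi k)) F (phi k).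
Proof.
rewrite (reindex phi); last exact: onW_bij.
by apply: eq_bigl => k; rewrite !inE phi_over.
Qed.

Lemma goeritz_off_transport (X Y : {set side D}) :
  X \in regions D -> Y \in regions D ->
  goeritz_off xi' (f @: X) (f @: Y) = (-1) ^+ e * goeritz_off xi X Y.
Proof.
move=> XD YD; rewrite /goeritz_off crossings_sum_transport mulrN mulr_sumr.
by congr (- _); apply: eq_big => k; rewrite ?phi_adjacent ?phi_incidence.
Qed.

Lemma goeritz_entry_transport (X Y : {set side D}) :
  X \in regions D -> Y \in regions D ->
  goeritz_entry xi' (f @: X) (f @: Y) = (-1) ^+ e * goeritz_entry xi X Y.
Proof.
move=> XD YD; rewrite /goeritz_entry (inj_eq (imset_inj f_inj)).
case: eqP => _; last exact: goeritz_off_transport.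
rewrite white_regions_transport mulrN mulr_sumr; congr (- _).
rewrite big_mkcondr big_imset /=; last by move=> Z Z1 _ _; apply: imset_inj.
rewrite [RHS]big_mkcondr; apply: eq_bigr => Z; rewrite inE => /andP[ZD _].
by rewrite (inj_eq (imset_inj f_inj)) goeritz_off_transport.
Qed.

(** Incidence numbers and writhes change by the same sign, so the types of the crossings are
    preserved. *)
Lemma correction_transport : correction xi' = (-1) ^+ e * correction xi.
Proof.
rewrite /correction crossings_sum_transport mulr_sumr.
apply: eq_big => k; last by rewrite phi_incidence.
by rewrite /type_II phi_incidence phi_writhe mulrACA -expr2 sqrr_sign mul1r.
Qed.

Lemma sigma_transport : sigma xi' = (-1) ^+ e * sigma xi.
Proof.
rewrite /sigma correction_transport mulrBr; congr (_ - _).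
(* [s] lists the white regions of [D'] in the order inherited from [D]. With this order the reduced
   matrix is that of [D] up to the sign, and [sig_laplacian_perm] compares it with the enumeration
   of [D']. *)
pose s := [seq f @: (X : {set side D}) | X <- enum (white_regions xi)].
have st : perm_eq s (enum (white_regions xi')).
  apply: uniq_perm; rewrite ?enum_uniq ?map_inj_uniq ?enum_uniq //.
    exact: imset_inj.
  move=> X; rewrite mem_enum white_regions_transport.
  apply/mapP/imsetP => -[Y]; first by rewrite mem_enum; exists Y.
  by exists Y; rewrite ?mem_enum.
have sW X : (X \in s) = (X \in white_regions xi') by rewrite (perm_mem st) mem_enum.
have sum0 : {in s, forall X, \sum_(Y <- s) goeritz_entry xi' X Y = 0}.
  by move=> X; rewrite sW (perm_big _ st) => /goeritz_row_sum.
have sz : size s = #|white_regions xi| by rewrite size_map -cardE.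
have sz' : size (enum (white_regions xi')) = #|white_regions xi'| by rewrite -cardE.
have symE : {in s &, forall X Y, goeritz_entry xi' X Y = goeritz_entry xi' Y X}.
  by move=> X Y _ _; apply: goeritz_entryC.
rewrite /goeritz -(sig_laplacian_perm set0 symE sum0 st sz sz').
transitivity (sig ((-1) ^+ e *: goeritz xi)); last first.
  by case: e; rewrite ?scale1r ?mul1r // scaleN1r mulN1r sigN ?goeritz_sym.
congr sig; apply/matrixP => i j; rewrite !mxE.
have lt (l : 'I_(#|white_regions xi|.-1)) : (l.+1 < size (enum (white_regions xi)))%N.
  by rewrite -cardE; case: #|_| l => [|n] [].
rewrite /s !(nth_map set0) // goeritz_entry_transport //.
- have := mem_nth set0 (lt i); by rewrite mem_enum inE => /andP[].
- have := mem_nth set0 (lt j); by rewrite mem_enum inE => /andP[].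
Qed.

End Transport.

(** Colorings are functions, and a double dual agrees with the original pointwise; transport along
    the identity turns this into an equality of signatures. *)
Lemma eq_sigma (D : gauss_diagram) (xi xi' : coloring D) :
  xi' =1 xi -> sigma xi' = sigma xi.
Proof.
move=> xi_eq; rewrite -[RHS]mul1r.
apply: (@sigma_transport D D id id _ _ _ _ xi xi' xi_eq false).
- by exists id.
- by exists id.
- by move=> s t; reflexivity.
- by move=> k; reflexivity.
- by move=> k X _; rewrite imset_id.
- by move=> k; rewrite mul1r /incidence !xi_eq.
- by move=> k; rewrite mul1r.
Qed.

(** * The mirror images and the inverse *)

Lemma partner_bij (D : gauss_diagram) : bijective (@partner D).
Proof. by exists (@partner D); apply: partnerK. Qed.

Lemma other_side_bij (D : gauss_diagram) : bijective (@other_side D).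
Proof. by exists (@other_side D); apply: other_sideK. Qed.

Lemma ccw_next_onto (D : gauss_diagram) (h : half_edge D) : exists h', h = ccw_next h'.
Proof. by exists (ccw_next (ccw_next (ccw_next h))); rewrite ccw_next4. Qed.

Section VerticalMirror.
Variable D : gauss_diagram.
Let V := vertical_mirror D.
Implicit Types (k : 'I_(len D)) (h : half_edge D) (s t : side D).

Lemma passage_at_vertical k : @passage_at V k = crossing_change (passage_at k).
Proof. exact: tnth_map. Qed.

Lemma over_vertical k : over (@passage_at V k) = ~~ over (passage_at k).
Proof. by rewrite passage_at_vertical. Qed.

Lemma positive_vertical k : positive (@passage_at V k) = ~~ positive (passage_at k).
Proof. by rewrite passage_at_vertical. Qed.

Lemma partner_vertical k : @partner V k = partner k.
Proof.
apply: (@partner_unique V); last exact: partner_neq.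
by rewrite !passage_at_vertical; apply: label_partner.
Qed.

(** The over flag and the sign are both negated, and the two changes cancel in the cyclic order: the
    flat diagram on its surface stays the same. *)
Lemma ccw_next_vertical h : @ccw_next V h = ccw_next h.
Proof.
rewrite /ccw_next partner_vertical over_vertical positive_vertical; congr (_, _).
by case: (over _); case: (positive _); case: h.2.
Qed.

Lemma joined_vertical s t : @joined V s t = joined s t.
Proof. by apply: eq_existsb => h; rewrite ccw_next_vertical. Qed.

Lemma over_partner_vertical k : over (@passage_at V (partner k)) = over (passage_at k).
Proof. by rewrite over_vertical over_partner negbK. Qed.

Lemma supporting_genus_vertical : supporting_genus V = supporting_genus D.
Proof.
apply: (@supporting_genus_transport D V id (@partner D)).
- by exists id.
- exact: (partner_bij D).
- exact: joined_vertical.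
- exact: over_partner_vertical.
Qed.

Variable xi : coloring D.
Hypothesis xiP : checkerboard xi.

Lemma vertical_checkerboard : checkerboard (vertical_coloring xi).
Proof.
apply: (@checkerboard_transport D V id _ _ _ xi).
- by exists id.
- exact: joined_vertical.
- by move=> s; reflexivity.
- by move=> s; reflexivity.
- exact: xiP.
Qed.

Lemma sigma_vertical : sigma (vertical_coloring xi) = - sigma xi.
Proof.
rewrite -mulN1r.
(* The over-passages of [V] are the under-passages of [D], whence [partner]; [true] selects the sign
   -1. *)
apply: (@sigma_transport D V id (@partner D) _ _ _ _ xi _ _ true).
- by exists id.
- exact: (partner_bij D).
- exact: joined_vertical.
- exact: over_partner_vertical.
- by move=> s; reflexivity.
- move=> k X XD; rewrite imset_id /adjacent partner_vertical partnerK.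
  by apply: eq_existsb => o; rewrite orbC.
- by move=> k; rewrite mulN1r -incidence_partner.
- move=> k; rewrite mulN1r /writhe positive_vertical.
  by rewrite positive_partner; case: (positive _); rewrite ?opprK.
Qed.

End VerticalMirror.

Section HorizontalMirror.
Variable D : gauss_diagram.
Let H := horizontal_mirror D.
Implicit Types (k : 'I_(len D)) (h : half_edge D) (s t : side D).

Lemma passage_at_horizontal k : @passage_at H k = sign_change (passage_at k).
Proof. exact: tnth_map. Qed.

Lemma over_horizontal k : over (@passage_at H k) = over (passage_at k).
Proof. by rewrite passage_at_horizontal. Qed.

Lemma positive_horizontal k :
  positive (@passage_at H k) = ~~ positive (passage_at k).
Proof. by rewrite passage_at_horizontal. Qed.

Lemma partner_horizontal k : @partner H k = partner k.
Proof.
apply: (@partner_unique H); last exact: partner_neq.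
by rewrite !passage_at_horizontal; apply: label_partner.
Qed.

(** The cyclic orders at positive and at negative crossings are the reverses of each other. *)
Lemma ccw_next_horizontal h : @ccw_next H (ccw_next h) = h.
Proof.
rewrite /ccw_next partner_horizontal over_horizontal positive_horizontal partnerK.
rewrite over_partner positive_partner; case: h => k b /=.
by case: (over _); case: (positive _); case: b.
Qed.

Lemma cw_side_horizontal h : @cw_side H h = other_side (ccw_side h).
Proof. by []. Qed.

Lemma ccw_side_horizontal h : @ccw_side H h = other_side (cw_side h).
Proof. by rewrite cw_sideE other_sideK. Qed.

(* The reflection reverses the cyclic order around the crossings and exchanges
   the two sides of every half-edge. *)
Lemma joined_other_horizontal s t :
  @joined H (other_side s) (other_side t) = joined s t.
Proof.
have other_inj := can_inj (@other_sideK D).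
apply/joinedP/joinedP => -[h hst].
(* The corner of [H] that starts at [h] is the corner of [D] that ends there, read backwards; hence
   the two alternatives are exchanged. *)
- have [h' hE] := ccw_next_onto (h : half_edge D); exists h'.
  rewrite hE ccw_next_horizontal in hst.
  rewrite (ccw_side_horizontal (ccw_next h')) (cw_side_horizontal h') in hst.
  by case: hst => -[/other_inj -> /other_inj ->]; [right|left].
- exists (ccw_next h).
  rewrite ccw_next_horizontal (ccw_side_horizontal (ccw_next h)) (cw_side_horizontal h).
  by case: hst => -[-> ->]; [right|left].
Qed.

Lemma supporting_genus_horizontal : supporting_genus H = supporting_genus D.
Proof.
apply: (@supporting_genus_transport D H (@other_side D) id).
- exact: (other_side_bij D).
- by exists id.
- exact: joined_other_horizontal.
- exact: over_horizontal.
Qed.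

Variable xi : coloring D.
Hypothesis xiP : checkerboard xi.

Lemma horizontal_coloring_other s :
  horizontal_coloring xi (other_side s) = dual xi s.
Proof. exact: checkerboard_other. Qed.

Lemma horizontal_checkerboard : checkerboard (horizontal_coloring xi).
Proof.
apply: (@checkerboard_transport D H (@other_side D) _ _ _ (dual xi)).
- exact: (other_side_bij D).
- exact: joined_other_horizontal.
- by move=> s; reflexivity.
- exact: horizontal_coloring_other.
- exact: (dual_checkerboard xiP).
Qed.

Lemma sigma_horizontal : sigma (horizontal_coloring xi) = - sigma (dual xi).
Proof.
rewrite -mulN1r.
apply: (@sigma_transport D H (@other_side D) id _ _ _ _ (dual xi) _ _ true).
- exact: (other_side_bij D).
- by exists id.
- exact: joined_other_horizontal.
- exact: over_horizontal.
- exact: horizontal_coloring_other.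
(* Counterclockwise sides in [H] are the images of clockwise sides in [D], so adjacency in [D] is
   first expressed by the latter. *)
- move=> k X XD; rewrite (adjacentE k XD) /adjacent partner_horizontal.
  apply: eq_existsb => o; rewrite !ccw_side_horizontal.
  by rewrite !(mem_imset X _ (can_inj (@other_sideK D))).
(* The half-edges of [H] and [D] have the same counterclockwise sides, so the incidence numbers are
   those of [xi]; the sign comes from the dual. *)
- by move=> k; rewrite mulN1r incidence_dual ?opprK.
- move=> k; rewrite mulN1r /writhe positive_horizontal.
  by case: (positive _); rewrite ?opprK.
Qed.

End HorizontalMirror.

(** Below the last index the map sends [a] to [n - 1 - a]; the last index, where [ordS] wraps
    around, is fixed. *)
Lemma rev_ordSK (n : nat) : involutive (fun a : 'I_n.+1 => rev_ord (ordS a)).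
Proof.
move=> a; apply: ord_inj => /=; rewrite !subSS.
have [an|] := ltnP a n; last first.
  move=> na; have -> : a = n :> nat by apply/eqP; rewrite eqn_leq na -ltnS ltn_ord.
  by rewrite modnn subn0 modnn subn0.
rewrite (modn_small (m := a.+1)) ?ltnS // -subSn // subSS.
by rewrite modn_small ?ltnS ?leq_subr // subKn // ltnW.
Qed.

(** The arc leaving a passage becomes, backwards, the arc entering its image. With an arbitrary [n]
    a case analysis can identify [n.-1.+1] with [n]. *)
Lemma inord_reversed (n : nat) (k : 'I_n) (b : bool) :
  @inord n.-1 (if ~~ b then rev_ord k else ord_pred (rev_ord k)) =
  rev_ord (ordS (@inord n.-1 (if b then k else ord_pred k))).
Proof.
case: n k => [[]|n] k //; case: b; rewrite !inord_val; last by rewrite ord_predK.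
apply: (can_inj (@ordSK _)); rewrite ord_predK.
by rewrite -{1}[k]rev_ordSK rev_ordK.
Qed.

Lemma rev_ord_bij n : bijective (@rev_ord n).
Proof. by exists (@rev_ord n); apply: rev_ordK. Qed.

Section Inverse.
Variable D : gauss_diagram.
Let I := inverse D.
Implicit Types (k : 'I_(len D)) (h : half_edge D) (s t : side D).

Definition reversed_side s : side D := (rev_ord (ordS s.1), ~~ s.2).

Lemma reversed_sideK : involutive reversed_side.
Proof. by move=> [a b]; rewrite /reversed_side /= rev_ordSK negbK. Qed.

Lemma reversed_side_bij : bijective reversed_side.
Proof. by exists reversed_side; apply: reversed_sideK. Qed.

Definition reversed_half_edge h : half_edge D := (rev_ord h.1, ~~ h.2).

Lemma reversed_half_edgeK : involutive reversed_half_edge.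
Proof. by move=> [k b]; rewrite /reversed_half_edge /= rev_ordK negbK. Qed.

Lemma passage_at_inverse k : @passage_at I k = passage_at (rev_ord k).
Proof.
by rewrite /passage_at !(tnth_nth (passage_at k)) /= nth_rev ?size_tuple.
Qed.

Lemma over_inverse k : over (@passage_at I (rev_ord k)) = over (passage_at k).
Proof. by rewrite passage_at_inverse rev_ordK. Qed.

Lemma positive_inverse k :
  positive (@passage_at I (rev_ord k)) = positive (passage_at k).
Proof. by rewrite passage_at_inverse rev_ordK. Qed.

Lemma partner_inverse k : @partner I (rev_ord k) = rev_ord (partner k).
Proof.
apply: (@partner_unique I); last by rewrite (inj_eq rev_ord_inj) partner_neq.
by rewrite !passage_at_inverse !rev_ordK label_partner.
Qed.

(** Reversing both strands keeps the sign of a crossing and acts on its half-edges as a half turn,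
    which respects the cyclic order. *)
Lemma ccw_next_inverse h :
  @ccw_next I (reversed_half_edge h) = reversed_half_edge (ccw_next h).
Proof.
case: h => k b; rewrite /ccw_next.
rewrite [(reversed_half_edge _).1]/= [(reversed_half_edge _).2]/=.
rewrite partner_inverse over_inverse positive_inverse.
rewrite /reversed_half_edge; congr (_, _) => /=.
by case: (over _); case: (positive _); case: b.
Qed.

Lemma arc_of_inverse h :
  @arc_of I (reversed_half_edge h) = rev_ord (ordS (arc_of h)).
Proof.
exact: inord_reversed.
Qed.

Lemma ccw_side_inverse h :
  @ccw_side I (reversed_half_edge h) = reversed_side (ccw_side h).
Proof. by rewrite /ccw_side arc_of_inverse. Qed.

Lemma cw_side_inverse h :
  @cw_side I (reversed_half_edge h) = reversed_side (cw_side h).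
Proof. by rewrite /cw_side arc_of_inverse. Qed.

Lemma joined_inverse s t :
  @joined I (reversed_side s) (reversed_side t) = joined s t.
Proof.
have reversed_inj := can_inj reversed_sideK.
apply/joinedP/joinedP => -[h hst]; exists (reversed_half_edge h).
- rewrite -[h]reversed_half_edgeK in hst.
  rewrite ccw_next_inverse ccw_side_inverse cw_side_inverse in hst.
  by case: hst => -[/reversed_inj -> /reversed_inj ->]; [left|right].
- rewrite ccw_next_inverse ccw_side_inverse cw_side_inverse.
  by case: hst => -[-> ->]; [left|right].
Qed.

Lemma supporting_genus_inverse : supporting_genus I = supporting_genus D.
Proof.
apply: (@supporting_genus_transport D I reversed_side (@rev_ord _)).
- exact: reversed_side_bij.
- exact: rev_ord_bij.
- exact: joined_inverse.
- exact: over_inverse.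
Qed.

Variable xi : coloring D.

Lemma inverse_coloring_reversed s : inverse_coloring xi (reversed_side s) = xi s.
Proof. exact: (congr1 xi (reversed_sideK s)). Qed.

Lemma inverse_checkerboard :
  checkerboard xi -> checkerboard (inverse_coloring xi).
Proof.
move=> xiP; apply: (@checkerboard_transport D I reversed_side _ _ _ xi).
- exact: reversed_side_bij.
- exact: joined_inverse.
- by move=> s; reflexivity.
- exact: inverse_coloring_reversed.
- exact: xiP.
Qed.

Lemma ccw_side_rev_ord k o :
  @ccw_side I (rev_ord k, o) = reversed_side (ccw_side (k, ~~ o)).
Proof. by rewrite -ccw_side_inverse /reversed_half_edge /= negbK. Qed.

Lemma sigma_inverse : sigma (inverse_coloring xi) = sigma xi.
Proof.
rewrite -[RHS]mul1r.
apply: (@sigma_transport D I reversed_side (@rev_ord _) _ _ _ _ xi _ _ false).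
- exact: reversed_side_bij.
- exact: rev_ord_bij.
- exact: joined_inverse.
- exact: over_inverse.
- exact: inverse_coloring_reversed.
- move=> k X _; rewrite /adjacent partner_inverse.
  apply/existsP/existsP => -[o ko]; exists (~~ o); move: ko.
    by rewrite !ccw_side_rev_ord !(mem_imset X _ (can_inj reversed_sideK)).
  by rewrite !ccw_side_rev_ord !(mem_imset X _ (can_inj reversed_sideK)) negbK.
- move=> k; rewrite mul1r /incidence !ccw_side_rev_ord.
  by rewrite !inverse_coloring_reversed andbC.
- by move=> k; rewrite mul1r /writhe positive_inverse.
Qed.

End Inverse.

Theorem theorem2p10 (D : gauss_diagram) (xi : coloring D)
    (hD : minimal_genus D) (hxi : checkerboard xi) :
  [/\ knot_signatures (inverse D) (inverse_coloring xi)
        (sigma xi, sigma (dual xi)),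
      knot_signatures (vertical_mirror D) (vertical_coloring xi)
        (- sigma xi, - sigma (dual xi)),
      knot_signatures (horizontal_mirror D) (horizontal_coloring xi)
        (- sigma (dual xi), - sigma xi)
    & knot_signatures (horizontal_mirror (vertical_mirror D))
        (horizontal_coloring (vertical_coloring xi))
        (sigma (dual xi), sigma xi)].
Proof.
have minI := minimal_genus_transform (op := inverse) (F := rev) (fun D' => erefl)
  (@revK _) rev_move supporting_genus_inverse.
have minV := minimal_genus_transform (op := vertical_mirror) (fun D' => erefl)
  (mapK crossing_changeK)
  crossing_change_move supporting_genus_vertical.
have minH := minimal_genus_transform (op := horizontal_mirror) (fun D' => erefl)
  (mapK sign_changeK)
  sign_change_move supporting_genus_horizontal.
have hV := vertical_checkerboard hxi.
have hV' := vertical_checkerboard (dual_checkerboard hxi).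
split; split.
- exact: minI.
- exact: inverse_checkerboard.
- congr (_, _); first exact: sigma_inverse.
  (* The dual of an induced coloring is, by computation, the coloring induced from the dual. *)
  exact: (sigma_inverse (dual xi)).
- exact: minV.
- exact: hV.
- congr (_, _); first exact: sigma_vertical.
  exact: (sigma_vertical (dual_checkerboard hxi)).
- exact: minH.
- exact: horizontal_checkerboard.
- congr (_, _); first exact: sigma_horizontal.
  rewrite -(eq_sigma (xi' := dual (dual xi)) (fun s => negbK (xi s))).
  exact: (sigma_horizontal (dual_checkerboard hxi)).
- exact/minH/minV.
- exact: (horizontal_checkerboard hV).
- congr (_, _).
    (* Each mirror image contributes a sign and these cancel; the exchange of colors by the
       horizontal one remains. *)
    rewrite (sigma_horizontal hV) -[RHS]opprK; congr (- _).
    exact: (sigma_vertical (dual_checkerboard hxi)).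
  rewrite -[RHS]opprK -(sigma_vertical hxi).
  rewrite -(eq_sigma (xi' := dual (dual (vertical_coloring xi))) (fun s => negbK (xi s))).
  exact: (sigma_horizontal hV').
Qed.
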